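(* Let $(T_n)_{n\ge 1}$ be a uniform random recursive tree and let $R_n$ be the betweenness rank of the root (vertex $1$) in $T_n$. Then there exists a constant $c>0$ (not depending on $n$) such that for all $n\ge 1$ and all $x\in[n]=\{1,\ldots,n\}$, $$\mathbb{P}(R_n>x)\le\frac{c}{x}.$$
   Context: A uniform random recursive tree (URRT) is a random sequence of trees $(T_n)_{n\ge 1}$ with $V(T_n)=[n]=\{1,\ldots,n\}$: $T_1$ is the single vertex $1$ (the root), and $T_{n+1}$ is obtained from $T_n$ by adding vertex $n+1$ and an edge $\{i,n+1\}$, where $i$ is chosen uniformly at random from $[n]$, independently of the past. The betweenness centrality of $v\in V(T_n)$ is $\mathcal{B}_{T_n}(v)=\sum_{s,t\in V(T_n):\,s,t\ne v}\mathbf{1}_{\{v\in\sigma_{s,t}\}}$, where $\sigma_{s,t}$ is the path between $s$ and $t$ in $T_n$ excluding $s$ and $t$; larger values correspond to more central vertices. Ranking: vertices are ordered from most to least central; vertices with equal centrality value are ordered in reverse order of insertion time (if $u,v$ have equal centrality, $u$ is ranked before $v$ iff $u>v$). This gives a permutation $\gamma_n$ of $[n]$, where $\gamma_n(v)\in\{1,\ldots,n\}$ is the position of $v$ in this order (position $1$ being most central). The rank of the root is $R_n=\gamma_n(1)$. *)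

(* Defs.v *)
(* MathComp / MathComp-Analysis *)
From HB Require Import structures.
From mathcomp Require Import all_boot all_order all_algebra.
From mathcomp Require Import all_classical all_reals all_analysis.

Set Implicit Arguments.
Unset Strict Implicit.
Unset Printing Implicit Defensive.

Import Order.TTheory GRing.Theory Num.Theory.

Local Open Scope classical_set_scope.
Local Open Scope ring_scope.

(* A graph with vertex set {1, ..., n} is represented by the bound n together
   with its adjacency relation on nat. *)

Definition add_edge (e : rel nat) (a b : nat) : rel nat := fun u v =>
  [|| e u v, (u == a) && (v == b) | (u == b) && (v == a)].

(* p lists the interior vertices of a simple path from s to t. There is no
   such p when s = t, which agrees with the convention that the path from s to
   s has no interior vertex. *)
Definition interior_path (e : rel nat) (s t : nat) (p : seq nat) : bool :=
  path e s (rcons p t) && uniq (s :: rcons p t).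

(* v \in \sigma_{s,t}; in a tree the path from s to t is unique. *)
Definition on_sigma (e : rel nat) (s t v : nat) : bool :=
  `[< exists2 p, interior_path e s t p & v \in p >].

(* The sum is over ordered pairs (s, t). *)
Definition betweenness (n : nat) (e : rel nat) (v : nat) : nat :=
  (\sum_(1 <= s < n.+1 | s != v) \sum_(1 <= t < n.+1 | t != v)
     on_sigma e s t v)%N.

Definition ranked_le (n : nat) (e : rel nat) : rel nat := fun u v =>
  ((betweenness n e v < betweenness n e u) ||
   (betweenness n e u == betweenness n e v) && (v <= u))%N.

Definition ranking (n : nat) (e : rel nat) : seq nat :=
  sort (ranked_le n e) (iota 1 n).

(* index counts from 0, positions from 1. *)
Definition betweenness_rank (n : nat) (e : rel nat) (v : nat) : nat :=
  (index v (ranking n e)).+1.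

(* T n w is the tree on {1, ..., n} (the value at n = 0 is irrelevant), and
   I n w is the vertex to which n.+1 is attached. The trees T 1, ..., T n are
   discrete random variables, so independence of I n from them is the product
   rule on the atoms {T 1 = g 1, ..., T n = g n}. *)
Definition is_urrt (d : measure_display) (Omega : measurableType d)
    (R : realType) (P : probability Omega R) (T : nat -> Omega -> rel nat) :
    Prop :=
  (forall w, T 1%N w =2 (fun _ _ => false)) /\
  exists I : nat -> {RV P >-> nat}, forall n : nat, (1 <= n)%N ->
  [/\ forall w, (1 <= I n w <= n)%N,
      forall w, T n.+1 w =2 add_edge (T n w) (I n w) n.+1,
      forall i : nat, (1 <= i <= n)%N ->
        P [set w | I n w = i] = (n%:R^-1)%:E
    & forall (i : nat) (g : nat -> rel nat),
        let past := [set w | forall k, (1 <= k <= n)%N -> T k w =2 g k] in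
        P ([set w | I n w = i] `&` past) =
        (P [set w | I n w = i] * P past)%E].

(* Main.v *)
Require Import Defs.
From HB Require Import structures.
From mathcomp Require Import all_boot all_order all_algebra.
From mathcomp Require Import all_classical all_reals all_analysis.
From mathcomp Require Import zify ring lra.

Set Implicit Arguments.
Unset Strict Implicit.
Unset Printing Implicit Defensive.

Import Order.TTheory GRing.Theory Num.Theory.

Local Open Scope classical_set_scope.
Local Open Scope ring_scope.

(* Let S be the size of the subtree of vertex 2 and D that of the subtree of v.
   Counting the pairs whose path passes through 1, resp. v, shows that a vertex
   v at least as central as the root satisfies (n-1)(D-1) >= S(n-1-S), hence
   2D >= A where A is one of the two parts S and n - S. Fix m of order x/2. If
   the rank of the root exceeds x, at least x/2 vertices born after time m are
   at least as central as the root. At time m, S is uniform on {1, ..., m-1}, so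
   the event that one part has size at most 2 then has probability at most
   4/(m-1). Outside of it D(D+1)/((A-1)(A-2)) is a nonnegative supermartingale
   for both parts, so by Markov's inequality v is as central as the root with
   conditional probability, given the past at its birth, at most the sum of
   8/((A-1)(A-2)) over the two parts. Since (n-1)(n-2)/((A-1)(A-2)) is a
   martingale, summing over v > m and over the uniform law of S bounds the
   expected number of such v by a constant, and Markov's inequality once more
   gives the bound c/x. *)

(** * Recursive trees *)

(* A recursive tree on {1, ..., n} is encoded by the list of the vertices to
   which n, n - 1, ..., 2 were attached, the most recent choice coming first. *)

Fixpoint rec_tree (l : seq nat) : rel nat :=
  if l is i :: l' then add_edge (rec_tree l') i (size l').+2
  else fun _ _ => false.

Fixpoint valid (l : seq nat) : bool :=
  if l is i :: l' then (0 < i <= (size l').+1)%N && valid l' else true.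

(* [desc l v u]: u belongs to the subtree of v, the tree being rooted at 1. *)
Fixpoint desc (l : seq nat) (v u : nat) : bool :=
  if l is i :: l' then
    if u == (size l').+2 then (u == v) || desc l' v i else desc l' v u
  else u == v.

Definition subtree_size (l : seq nat) (v : nat) : nat :=
  (\sum_(1 <= u < (size l).+2) desc l v u)%N.

Lemma rec_tree_sym l u w : rec_tree l u w = rec_tree l w u.
Proof.
elim: l => //= i l IH; rewrite /add_edge IH; congr (_ || _).
by rewrite orbC; congr (_ || _); rewrite andbC.
Qed.

Lemma rec_tree_range l u w : valid l -> rec_tree l u w ->
  (0 < u <= (size l).+1)%N.
Proof.
elim: l u w => //= i l IH u w /andP[hi hl].
by case/or3P=> [/(IH _ _ hl)|/andP[/eqP-> _]|/andP[/eqP-> _]]; lia.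
Qed.

Lemma desc_refl l v : desc l v v.
Proof. by elim: l => //= i l IH; rewrite eqxx IH; case: ifP. Qed.

Lemma desc_lt l v u : valid l -> (u < v)%N -> (u <= (size l).+1)%N ->
  desc l v u = false.
Proof.
elim: l u => [u _ /ltn_eqF//|i l IH u /= /andP[hi hl] uv un].
case: eqP => [E|E]; last by apply: IH => //; lia.
rewrite ltn_eqF //= IH //; lia.
Qed.

Lemma desc_trans_const l v w u : (w < v)%N -> (v <= (size l).+1)%N -> valid l ->
  desc l v u -> (u <= (size l).+1)%N -> desc l w u = desc l w v.
Proof.
move=> wv; elim: l u => [u /= vn _ /eqP->//|i l IH u /= vn /andP[hi hl]].
case: (eqVneq u) => [->|Eu].
  move=> /orP[/eqP Ev _|dv _]; first by rewrite -Ev eqxx.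
  case: (eqVneq v) => [Ev|Ev]; first by rewrite {1}Ev desc_lt // in dv; lia.
  rewrite gtn_eqF /=; last lia.
  by apply: IH => //; lia.
move=> dv un.
case: (eqVneq v) => [Ev|Ev]; first by rewrite {1}Ev desc_lt // in dv; lia.
by apply: IH => //; lia.
Qed.

(* The parent of v is the only gate between its subtree and the other
   vertices. *)
Lemma subtree_gate l v : valid l -> exists q, forall u w,
  rec_tree l u w -> ~~ desc l v u -> desc l v w -> u = q.
Proof.
elim: l => [_|i l IH /= /andP[hi hl]]; first by exists 0%N.
have [->|vN] := eqVneq v (size l).+2.
  exists i => u w /or3P[e|/andP[/eqP->//]|/andP[/eqP-> _]]; last first.
    by rewrite !eqxx.
  have ru := rec_tree_range hl e.
  have rw : (0 < w <= (size l).+1)%N.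
    by rewrite rec_tree_sym in e; apply: (rec_tree_range hl e).
  by move=> _; case: eqP => [|_]; [lia|rewrite desc_lt//; lia].
have [q Hq] := IH hl; exists q => u w.
have Ni : (i == (size l).+2) = false by lia.
move=> /or3P[e|/andP[/eqP-> /eqP->]|/andP[/eqP-> /eqP->]]; last 2 first.
- by rewrite eqxx Ni eq_sym (negPf vN) /= => /negPf->.
- by rewrite eqxx Ni eq_sym (negPf vN) /= => /negPf->.
have ru := rec_tree_range hl e.
have rw : (0 < w <= (size l).+1)%N.
  by rewrite rec_tree_sym in e; apply: (rec_tree_range hl e).
have -> : (u == (size l).+2) = false by lia.
have -> : (w == (size l).+2) = false by lia.
exact: Hq.
Qed.

Lemma path_through_gate l v q s p : (forall u w,
    rec_tree l u w -> ~~ desc l v u -> desc l v w -> u = q) ->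
  path (rec_tree l) s (rcons p v) -> ~~ desc l v s -> q \in s :: p.
Proof.
move=> Hq; elim: p s => [|y p IH] s /= /andP[sy py] ds.
  by rewrite inE (Hq _ _ sy ds) // desc_refl.
have [dy|dy] := boolP (desc l v y); first by rewrite (Hq _ _ sy ds) // mem_head.
by rewrite inE IH // orbT.
Qed.

Lemma on_sigma_desc l v s t : valid l -> on_sigma (rec_tree l) s t v ->
  desc l v s || desc l v t.
Proof.
move=> hl /asboolP[p /andP[pp up] vp]; apply: contraT; rewrite negb_or.
case/andP=> ds dt; have [q Hq] := subtree_gate v hl.
move: vp pp up => /splitPr[p1 p2].
rewrite rcons_cat -cat_rcons => pp; rewrite -cat_cons => up.
move: pp; rewrite cat_path last_rcons.
move=> /andP[/(path_through_gate Hq)/(_ ds) q1 pp2].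
have : q \in t :: rev p2.
  apply: (@path_through_gate l v) => //.
  have := rev_path (rec_tree l) v (rcons p2 t).
  rewrite last_rcons belast_rcons rev_cons => ->.
  by apply: sub_path pp2 => a b; rewrite rec_tree_sym.
move=> q2; move: up; rewrite cat_uniq => /and3P[_ /hasPn/(_ q) H _].
have {}q2 : q \in rcons p2 t by move: q2; rewrite mem_rcons !in_cons mem_rev.
by move: (H q2); rewrite /= in_cons mem_rcons in_cons orbCA -in_cons q1 orbT.
Qed.

Lemma on_sigma_sym l v s t :
  on_sigma (rec_tree l) s t v -> on_sigma (rec_tree l) t s v.
Proof.
move=> /asboolP[p /andP[pp up] vp]; apply/asboolP.
have E : t :: rcons (rev p) s = rev (s :: rcons p t).
  by rewrite rev_cons rev_rcons.
exists (rev p); last by rewrite mem_rev.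
rewrite /interior_path E rev_uniq up andbT.
have := rev_path (rec_tree l) s (rcons p t).
rewrite last_rcons belast_rcons rev_cons => ->.
by apply: sub_path pp => a b; rewrite rec_tree_sym.
Qed.

Lemma path_to_root l s : valid l -> (1 < s <= (size l).+1)%N ->
  exists p, interior_path (rec_tree l) s 1 p /\
    all (fun u => (u <= (size l).+1)%N && (desc l 2 u == desc l 2 s)) p.
Proof.
elim: l s => [|i l IH] s; first by move=> _ /=; lia.
move=> /= /andP[hi hl] hs.
have add p u t : path (rec_tree l) u (rcons p t) ->
    path (add_edge (rec_tree l) i (size l).+2) u (rcons p t).
  by apply: sub_path => a b; rewrite /add_edge => ->.
have addd s0 p :
  all (fun u => (u <= (size l).+1)%N && (desc l 2 u == desc l 2 s0)) p ->
  all (fun u => (u <= (size l).+2)%N &&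
   ((if u == (size l).+2 then (u == 2) || desc l 2 i else desc l 2 u) ==
    desc l 2 s0)) p.
  apply: sub_all => u /andP[un du] /=.
  by rewrite ltn_eqF // du andbT; lia.
have [sN|sN] := eqVneq s (size l).+2; last first.
  have [p [/andP[pp up] pd]] : exists p, interior_path (rec_tree l) s 1 p /\
      all (fun u => (u <= (size l).+1)%N && (desc l 2 u == desc l 2 s)) p.
    by apply: IH => //; lia.
  by exists p; rewrite /interior_path add //; split=> //; apply: addd.
have e : add_edge (rec_tree l) i (size l).+2 s i.
  by rewrite /add_edge sN !eqxx !orbT.
have [i1|i1] := eqVneq i 1%N.
  exists [::]; split=> //; rewrite /interior_path /= -{1}i1 e /=.
  by rewrite !inE andbT; lia.
have [p [/andP[pp up] pd]] : exists p, interior_path (rec_tree l) i 1 p /\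
    all (fun u => (u <= (size l).+1)%N && (desc l 2 u == desc l 2 i)) p.
  by apply: IH => //; lia.
exists (i :: p); split; last first.
  rewrite /= -{1}sN ltn_eqF; last lia.
  rewrite (_ : (s == 2) = false) ?eqxx /=; last lia.
  by rewrite addd // andbT; lia.
rewrite /interior_path rcons_cons cons_uniq up andbT /= e add //=.
rewrite inE mem_rcons inE !negb_or; apply/and3P; split; try lia.
by apply/negP => /(allP pd) /andP[]; lia.
Qed.

Lemma on_sigma_root l s t : valid l ->
  (1 < s <= (size l).+1)%N -> (1 < t <= (size l).+1)%N ->
  desc l 2 s -> ~~ desc l 2 t -> on_sigma (rec_tree l) s t 1.
Proof.
move=> hl hs ht ds dt.
have [p [/andP[pp up] pd]] := path_to_root hl hs.
have [q [/andP[pq uq] qd]] := path_to_root hl ht.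
apply/asboolP; exists (p ++ 1%N :: rev q); last first.
  by rewrite mem_cat mem_head orbT.
rewrite /interior_path rcons_cat /= -cat_rcons; apply/andP; split.
  rewrite cat_path pp last_rcons /=.
  have := rev_path (rec_tree l) t (rcons q 1%N).
  rewrite last_rcons belast_rcons rev_cons => ->.
  by apply: sub_path pq => a b; rewrite rec_tree_sym.
rewrite -[_ && _]/(uniq (s :: _)) -cat_cons cat_uniq up /=.
have -> : rcons (rev q) t = rev (t :: q) by rewrite rev_cons.
rewrite rev_uniq; apply/andP; split; last first.
  by move: uq; rewrite -rcons_cons rcons_uniq => /andP[].
apply/hasPn => z; rewrite mem_rev => zq; apply/negP => zp.
have z1 : z != 1%N.
  apply/eqP => z1; move: uq; rewrite -rcons_cons rcons_uniq => /andP[/negP].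
  by rewrite -z1.
have dz : ~~ desc l 2 z.
  move: zq; rewrite inE => /orP[/eqP->//|/(allP qd)/andP[_ /eqP->]] //.
case/negP: dz.
move: zp; rewrite inE => /orP[/eqP->//|]; rewrite mem_rcons inE (negPf z1) /=.
by move=> /(allP pd) /andP[_ /eqP->].
Qed.

(** * Betweenness and subtree sizes *)

Lemma sum_subtree_size l v : (0 < v <= (size l).+1)%N ->
  (subtree_size l v = 1 + \sum_(1 <= u < (size l).+2 | u != v) desc l v u)%N.
Proof.
move=> hv; rewrite /subtree_size (bigD1_seq v) ?iota_uniq //=; last first.
  by rewrite mem_index_iota; lia.
by rewrite desc_refl.
Qed.

Lemma sum1_nat_neq (n v : nat) : (0 < v <= n.+1)%N ->
  (\sum_(1 <= u < n.+2 | u != v) 1 = n)%N.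
Proof.
move=> hv; have : (\sum_(1 <= u < n.+2) 1 = n.+1)%N.
  by rewrite sum_nat_const_nat; lia.
rewrite (bigD1_seq v) ?iota_uniq //=; last by rewrite mem_index_iota; lia.
lia.
Qed.

Lemma sum_const_nat_neq (n v k : nat) : (0 < v <= n.+1)%N ->
  (\sum_(1 <= u < n.+2 | u != v) k = n * k)%N.
Proof.
move=> hv; rewrite -[RHS](congr1 (muln^~ k) (sum1_nat_neq hv)) big_distrl /=.
by under [RHS]eq_bigr do rewrite mul1n.
Qed.

Lemma betweenness_le l v : valid l -> (0 < v <= (size l).+1)%N ->
  (betweenness (size l).+1 (rec_tree l) v
     <= 2 * size l * (subtree_size l v).-1)%N.
Proof.
move=> hl hv; rewrite sum_subtree_size //= /betweenness.
apply: (@leq_trans (\sum_(1 <= s < (size l).+2 | s != v)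
    \sum_(1 <= t < (size l).+2 | t != v) (desc l v s + desc l v t))%N).
  apply: leq_sum => s _; apply: leq_sum => t _.
  case: (boolP (on_sigma _ _ _ _)) => // /(on_sigma_desc hl).
  by case: (desc l v s) (desc l v t) => [] [].
under eq_bigr do rewrite big_split /= sum_const_nat_neq //.
by rewrite big_split /= -big_distrr sum_const_nat_neq //=; lia.
Qed.

Lemma betweenness_root_ge l : valid l -> (0 < size l)%N ->
  (2 * subtree_size l 2 * (size l - subtree_size l 2)
     <= betweenness (size l).+1 (rec_tree l) 1)%N.
Proof.
move=> hl l0.
pose a u := desc l 2 u; pose b u := ~~ desc l 2 u.
have Ea : subtree_size l 2 = (\sum_(1 <= u < (size l).+2 | u != 1) a u)%N.
  rewrite /subtree_size (bigD1_seq 1) ?iota_uniq ?mem_index_iota //=.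
  by rewrite desc_lt.
have Eb : (size l - subtree_size l 2 =
    \sum_(1 <= u < (size l).+2 | u != 1) b u)%N.
  have : (\sum_(1 <= u < (size l).+2 | u != 1) (a u + b u) = size l)%N.
    rewrite -[RHS](@sum1_nat_neq (size l) 1) //; apply: eq_bigr => u _.
    by rewrite /a /b; case: desc.
  by rewrite big_split /= -Ea; lia.
apply: (@leq_trans (\sum_(1 <= s < (size l).+2 | s != 1)
    \sum_(1 <= t < (size l).+2 | t != 1) (a s * b t + b s * a t))%N).
  under eq_bigr do rewrite big_split /= -!big_distrr /=.
  by rewrite big_split /= -!big_distrl /= -Ea -Eb; lia.
rewrite /betweenness big_nat_cond [X in (_ <= X)%N]big_nat_cond.
apply: leq_sum => s hs; rewrite big_nat_cond [X in (_ <= X)%N]big_nat_cond.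
apply: leq_sum => t ht.
suff : (a s && b t) || (b s && a t) ==> on_sigma (rec_tree l) s t 1.
  rewrite /a /b; case: desc; case: desc => //=; by case: on_sigma.
apply/implyP => /orP[] /andP[h1 h2]; first by apply: on_sigma_root => //; lia.
by apply: on_sigma_sym; apply: on_sigma_root => //; lia.
Qed.

Lemma more_central_large_subtree l v : valid l -> (1 < v <= (size l).+1)%N ->
  (betweenness (size l).+1 (rec_tree l) 1
     <= betweenness (size l).+1 (rec_tree l) v)%N ->
  (subtree_size l 2 <= 2 * subtree_size l v)%N ||
  ((size l).+1 - subtree_size l 2 <= 2 * subtree_size l v)%N.
Proof.
move=> hl hv B1v.
have l0 : (0 < size l)%N by lia.
have := leq_trans (betweenness_root_ge hl l0) (leq_trans B1v _).
have hv' : (0 < v <= (size l).+1)%N by lia.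
move=> /(_ _ (betweenness_le hl hv')).
have : (0 < subtree_size l v)%N by rewrite sum_subtree_size.
case: (subtree_size l v) => // D _ /=.
set S := subtree_size l 2; set n := size l => H.
apply: contraT; rewrite negb_or -!ltnNge => /andP[h1 h2].
nia.
Qed.

Lemma rank_le_count l x : let n := (size l).+1 in
  (x < betweenness_rank n (rec_tree l) 1)%N ->
  (x <= \sum_(2 <= v < n.+1)
     (betweenness n (rec_tree l) 1 <= betweenness n (rec_tree l) v))%N.
Proof.
move=> n; rewrite /betweenness_rank ltnS => /leq_trans; apply.
set e := rec_tree l; set s := ranking n e.
pose B v := (betweenness n e 1 <= betweenness n e v)%N.
have s1 : 1%N \in s by rewrite mem_sort mem_iota; lia.
have tr : transitive (ranked_le n e).
  by move=> u v w; rewrite /ranked_le; lia.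
have tot : total (ranked_le n e).
  by move=> u v; rewrite /ranked_le; lia.
have -> : (\sum_(2 <= v < n.+1) B v = count [pred v | (v != 1) && B v] s)%N.
  rewrite (permP (permEl (perm_sort _ _))) -sum1_count.
  rewrite -[iota 1 n]/(iota 1 n.-1.+1) /= big_cons /=.
  rewrite (_ : iota 2 _ = index_iota 2 n.+1); last first.
    by rewrite /index_iota /n !subSS subn0.
  rewrite [RHS]big_mkcond; apply: eq_big_nat => v hv /=.
  by rewrite gtn_eqF //; case/andP: hv.
apply: (@leq_trans (count [pred v | (v != 1) && B v] (take (index 1%N s) s))).
  2: rewrite -[X in (_ <= count _ X)%N](cat_take_drop (index 1%N s)).
  2: by rewrite count_cat leq_addr.
suff : all [pred v | (v != 1%N) && B v] (take (index 1%N s) s).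
  by rewrite all_count size_takel ?index_size // => /eqP ->.
apply/(all_nthP 0%N) => i; rewrite size_takel ?index_size // => hi /=.
rewrite nth_take //; apply/andP; split.
  by have /= -> := before_find 0%N hi.
have := sorted_ltn_nth tr 0%N (sort_sorted tot (iota 1 n)).
move=> /(_ i (index 1%N s)); rewrite !inE -/(ranking n e) -/s index_mem s1.
rewrite (ltn_trans hi) ?index_mem // nth_index // => /(_ isT isT hi).
by rewrite /ranked_le /B; lia.
Qed.

(** * Averages over uniform attachments *)

(* [size l + 1] is the number of vertices, so [avg F l] is the conditional
   expectation of F given the history l, one attachment later. *)
Definition avg (R : realFieldType) (F : seq nat -> R) (l : seq nat) : R :=
  (size l).+1%:R^-1 * \sum_(1 <= i < (size l).+2) F (i :: l).

Definition growth_stable (I : seq nat -> Prop) := forall i l,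
  (0 < i <= (size l).+1)%N -> I l -> I (i :: l).

Section Averages.
Variable R : realFieldType.
Implicit Types (F G : seq nat -> R) (l : seq nat) (I : seq nat -> Prop).

Lemma avg_le F G l :
  (forall i, (0 < i <= (size l).+1)%N -> F (i :: l) <= G (i :: l)) ->
  avg F l <= avg G l.
Proof.
move=> FG; rewrite /avg ler_wpM2l ?invr_ge0 // !big_nat.
by apply: ler_sum => i hi; apply: FG; lia.
Qed.

Lemma avg_cst (c : R) l : avg (fun=> c) l = c.
Proof.
rewrite /avg sumr_const_nat subn1 /= -[c *+ _]mulr_natl mulrA mulVf ?mul1r //.
Qed.

Lemma avgZ (c : R) F l : avg (fun l' => c * F l') l = c * avg F l.
Proof. by rewrite /avg -mulr_sumr mulrCA. Qed.

Lemma avgD F G l : avg (fun l' => F l' + G l') l = avg F l + avg G l.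
Proof. by rewrite /avg big_split mulrDr. Qed.

Lemma iter_avg_le I F G l j : growth_stable I -> I l ->
  (forall l', I l' -> size l' = (j + size l)%N -> F l' <= G l') ->
  iter j (@avg R) F l <= iter j (@avg R) G l.
Proof.
move=> stI; elim: j l => [|j IH] l Il FG /=; first exact: FG.
apply: avg_le => i hi; apply: IH; first exact: stI.
by move=> l' Il' E; apply: FG => //; rewrite E /= addnS.
Qed.

Lemma iter_avg_eq I F G l j : growth_stable I -> I l ->
  (forall l', I l' -> size l' = (j + size l)%N -> F l' = G l') ->
  iter j (@avg R) F l = iter j (@avg R) G l.
Proof.
move=> stI Il FG; apply/eqP; rewrite eq_le.
by rewrite !(iter_avg_le stI) // => l' Il' E; rewrite FG.
Qed.

Lemma iter_avg_cst (c : R) l j : iter j (@avg R) (fun=> c) l = c.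
Proof.
elim: j l => //= j IH l; rewrite -[RHS](avg_cst c l) /avg.
by under eq_bigr do rewrite IH.
Qed.

Lemma iter_avgZ (c : R) F l j :
  iter j (@avg R) (fun l' => c * F l') l = c * iter j (@avg R) F l.
Proof.
elim: j l => //= j IH l; rewrite -avgZ /avg.
by under eq_bigr do rewrite IH.
Qed.

Lemma iter_avgD F G l j : iter j (@avg R) (fun l' => F l' + G l') l =
  iter j (@avg R) F l + iter j (@avg R) G l.
Proof.
elim: j l => //= j IH l; rewrite -avgD /avg.
by under eq_bigr do rewrite IH.
Qed.

Lemma iter_avg_sum (s : seq nat) (F : nat -> seq nat -> R) l j :
  iter j (@avg R) (fun l' => \sum_(v <- s) F v l') l =
  \sum_(v <- s) iter j (@avg R) (F v) l.
Proof.
elim: s => [|v s IH].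
  rewrite big_nil -[RHS](iter_avg_cst 0 l j); congr (iter j _ _ l).
  by apply/funext => l'; rewrite big_nil.
rewrite big_cons -IH -iter_avgD; congr (iter j _ _ l).
by apply/funext => l'; rewrite big_cons.
Qed.

Lemma iter_avg_super I F l j : growth_stable I -> I l ->
  (forall l', I l' -> avg F l' <= F l') -> iter j (@avg R) F l <= F l.
Proof.
move=> stI Il sF; elim: j l Il => //= j IH l Il.
by apply: le_trans (sF _ Il); apply: avg_le => i hi; apply: IH; apply: stI.
Qed.

End Averages.

Lemma valid_stable : growth_stable valid.
Proof. by move=> i l /= ->. Qed.

Lemma subtree_size_cons i l v : (0 < i <= (size l).+1)%N ->
  v != (size l).+2 ->
  subtree_size (i :: l) v = (subtree_size l v + desc l v i)%N.
Proof.
move=> hi vN; rewrite /subtree_size big_nat_recr //= eqxx eq_sym (negPf vN) /=.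
congr addn; apply: eq_big_nat => u hu.
by rewrite ltn_eqF //; case/andP: hu.
Qed.

Lemma subtree_size_new i l : (0 < i <= (size l).+1)%N -> valid l ->
  subtree_size (i :: l) (size l).+2 = 1%N.
Proof.
move=> hi hl; rewrite /subtree_size big_nat_recr //= eqxx /=.
rewrite big_nat big1 // => u hu; rewrite ltn_eqF; last by case/andP: hu.
by rewrite desc_lt //; lia.
Qed.

(* The vertices are split into the subtree of 2 (b = true) and the part
   containing the root (b = false). *)
Definition side_size (b : bool) (l : seq nat) : nat :=
  (\sum_(1 <= u < (size l).+2) (desc l 2 u == b))%N.

Lemma side_sizeT l : side_size true l = subtree_size l 2.
Proof. by apply: eq_bigr => u _; rewrite eqb_id. Qed.

Lemma side_sizeF l : side_size false l = ((size l).+1 - subtree_size l 2)%N.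
Proof.
suff : (side_size false l + subtree_size l 2 = (size l).+1)%N by lia.
rewrite /side_size /subtree_size -big_split /=.
transitivity (\sum_(1 <= u < (size l).+2) 1)%N.
  by apply: eq_bigr => u _; case: (desc l 2 u).
by rewrite sum_nat_const_nat subn1 muln1.
Qed.

Lemma side_size_cons b i l : (0 < i <= (size l).+1)%N -> (0 < size l)%N ->
  side_size b (i :: l) = (side_size b l + (desc l 2 i == b))%N.
Proof.
move=> hi l0; rewrite /side_size big_nat_recr //= eqxx.
rewrite (_ : (_ == 2) = false) /=; last lia.
by congr addn; apply: eq_big_nat => u hu; rewrite ltn_eqF //; case/andP: hu.
Qed.

Definition balanced (l : seq nat) : Prop :=
  [/\ valid l, (2 < side_size true l)%N & (2 < side_size false l)%N].

Lemma balanced_size l : balanced l -> (4 < size l)%N.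
Proof. by case=> _; rewrite side_sizeT side_sizeF; lia. Qed.

Lemma balanced_stable : growth_stable balanced.
Proof.
move=> i l hi bl; have l0 : (0 < size l)%N by have := balanced_size bl; lia.
case: bl => hl h1 h2; split; rewrite ?side_size_cons //; try lia.
by rewrite /= hi.
Qed.

(** * Potentials *)

Section Potentials.
Variable R : realFieldType.

Lemma sum_two_colours (G : nat -> nat -> R) (a c : pred nat) (n A D : nat) :
  \sum_(1 <= i < n.+1) G (A + a i)%N (D + c i)%N =
    n%:R * G A D
    + (\sum_(1 <= i < n.+1) a i)%:R * (G A.+1 D - G A D)
    + (\sum_(1 <= i < n.+1) c i)%:R * (G A D.+1 - G A D)
    + (\sum_(1 <= i < n.+1) (a i && c i))%:R *
      (G A.+1 D.+1 - G A D.+1 - G A.+1 D + G A D).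
Proof.
have E (x : R) : n%:R * x = \sum_(1 <= i < n.+1) x.
  by rewrite sumr_const_nat subn1 mulr_natl.
rewrite !natr_sum E !mulr_suml -!big_split; apply: eq_bigr => i _ /=.
by case: (a i); case: (c i); rewrite /= ?addn0 ?addn1; ring.
Qed.

Definition inv_pot (b : bool) (l : seq nat) : R :=
  (((side_size b l)%:R - 1) * ((side_size b l)%:R - 2))^-1.

(* Under uniform attachment D (D + 1) / ((A - 1) (A - 2)) is a martingale when D
   and A count disjoint sets of vertices, and a supermartingale when the
   vertices counted by D are among those counted by A. *)
Definition ratio_pot (b : bool) (v : nat) (l : seq nat) : R :=
  (subtree_size l v)%:R * (subtree_size l v).+1%:R * inv_pot b l.

Lemma inv_pot_gt0 b l : balanced l -> 0 < inv_pot b l.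
Proof.
move=> [_ h1 h2]; have : (2 < side_size b l)%N by case: b.
rewrite -(ltr_nat R) /inv_pot invr_gt0 => h; apply: mulr_gt0; lra.
Qed.

Lemma avg_inv_pot b l : balanced l ->
  avg (inv_pot b) l = ((size l).+1%:R - 2) / (size l).+1%:R * inv_pot b l.
Proof.
move=> bl; have sl := balanced_size bl; case: (bl) => hl h1 h2.
have hA : (2 < side_size b l)%N by case: (b).
pose G (A D : nat) : R := ((A%:R - 1) * (A%:R - 2))^-1.
have -> : avg (inv_pot b) l = (size l).+1%:R^-1 *
    \sum_(1 <= i < (size l).+2)
      G (side_size b l + (desc l 2 i == b))%N (0 + false)%N.
  congr (_ * _); apply: eq_big_nat => i hi.
  by rewrite /inv_pot /G side_size_cons //; lia.
rewrite (sum_two_colours G (fun i => desc l 2 i == b) (fun=> false)).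
rewrite -/(side_size b l) /inv_pot /G.
rewrite big1 // -natr1 [X in _ + X%:R * _]big1; last first.
  by move=> i _; rewrite andbF.
move: hA; rewrite -(ltr_nat R); set A := (side_size b l)%:R => hA.
have n0 : 0 <= (size l)%:R :> R by [].
by field; rewrite -/A; apply/and4P; split; apply: lt0r_neq0; lra.
Qed.

Lemma avg_ratio_pot_le b v l : balanced l -> (2 < v <= (size l).+1)%N ->
  avg (ratio_pot b v) l <= ratio_pot b v l.
Proof.
move=> bl hv; have sl := balanced_size bl; case: (bl) => hl h1 h2.
have hA : (2 < side_size b l)%N by case: (b).
pose G (A D : nat) : R := D%:R * D.+1%:R * ((A%:R - 1) * (A%:R - 2))^-1.
have -> : avg (ratio_pot b v) l = (size l).+1%:R^-1 *
    \sum_(1 <= i < (size l).+2) G (side_size b l + (desc l 2 i == b))%N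
                                  (subtree_size l v + desc l v i)%N.
  congr (_ * _); apply: eq_big_nat => i hi.
  by rewrite /ratio_pot /inv_pot /G side_size_cons ?subtree_size_cons //; lia.
rewrite (sum_two_colours G (fun i => desc l 2 i == b) (desc l v)).
rewrite -/(side_size b l) -/(subtree_size l v).
have -> : (\sum_(1 <= i < (size l).+2) ((desc l 2 i == b) && desc l v i) =
    (desc l 2 v == b) * subtree_size l v)%N.
  rewrite /subtree_size big_distrr; apply: eq_big_nat => i hi /=.
  case: (boolP (desc l v i)) => [dvi|_]; last by rewrite andbF muln0.
  by rewrite andbT muln1 (@desc_trans_const l v 2 i) //; lia.
rewrite /ratio_pot /inv_pot /G -!natr1.
move: hA; rewrite -(ltr_nat R); set A := (side_size b l)%:R => hA.
set D := (subtree_size l v)%:R.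
have n0 : 0 <= (size l)%:R :> R by [].
have D0 : 0 <= D by rewrite ler0n.
case: (desc l 2 v == b); rewrite ?mul1n ?mul0n -/D.
  rewrite -subr_ge0.
  set X := (X in 0 <= X).
  have -> : X =
      4 * D * (D + 1) * ((A - 1) * (A - 2) * A * ((size l)%:R + 1))^-1.
    rewrite /X; field; apply/and4P; split; apply: lt0r_neq0; lra.
  have D1 : 0 <= D + 1 by lra.
  by rewrite !mulr_ge0 ?invr_ge0 ?mulr_ge0 //; lra.
rewrite le_eqVlt; apply/orP; left; apply/eqP; field.
apply/and4P; split; apply: lt0r_neq0; lra.
Qed.

Lemma iter_avg_inv_pot b l j : balanced l ->
  iter j (@avg R) (inv_pot b) l =
  ((size l)%:R * ((size l)%:R - 1)) /
  (((size l + j)%:R) * ((size l + j)%:R - 1)) * inv_pot b l.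
Proof.
elim: j l => [|j IH] l bl.
  have := balanced_size bl; rewrite addn0 -(ltr_nat R) => sl.
  by rewrite divff ?mul1r //; apply: lt0r_neq0; apply: mulr_gt0; lra.
have sl := balanced_size bl.
rewrite /= /avg; under eq_big_nat => i hi.
  rewrite IH /=; last exact: balanced_stable.
  over.
rewrite -mulr_sumr mulrCA -/(avg (inv_pot b) l) avg_inv_pot // addSnnS.
move: sl; rewrite natrD -!natr1 -(ltr_nat R) => sl.
have j0 : 0 <= j%:R :> R by [].
by field; apply/and3P; split; apply: lt0r_neq0; lra.
Qed.

Definition beats_root (l : seq nat) (v : nat) : bool :=
  (betweenness (size l).+1 (rec_tree l) 1
     <= betweenness (size l).+1 (rec_tree l) v)%N.

Lemma beats_root_le_pot l v : balanced l -> (2 < v <= (size l).+1)%N ->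
  (beats_root l v)%:R <= 4 * (ratio_pot true v l + ratio_pot false v l).
Proof.
move=> bl hv; case: (bl) => hl h1 h2.
have half b : (side_size b l <= 2 * subtree_size l v)%N ->
    1 <= 4 * ratio_pot b v l.
  have hA : (2 < side_size b l)%N by case: (b).
  rewrite /ratio_pot /inv_pot -natr1 mulrA -(ler_nat R) natrM.
  move: hA; rewrite -(ltr_nat R); set A := _%:R; set D := _%:R => hA AD.
  rewrite ler_pdivlMr ?mul1r; last by apply: mulr_gt0; lra.
  nra.
have pos b : 0 <= ratio_pot b v l.
  by rewrite /ratio_pot mulr_ge0 ?mulr_ge0 // ltW // inv_pot_gt0.
have := pos true; have := pos false => p1 p2.
case: (boolP (beats_root l v)) => [|_]; last by rewrite /=; lra.
move=> /(more_central_large_subtree hl) H.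
have {}H : (side_size true l <= 2 * subtree_size l v)%N ||
  (side_size false l <= 2 * subtree_size l v)%N.
  by rewrite side_sizeT side_sizeF; apply: H; lia.
by rewrite /=; case/orP: H => /half; lra.
Qed.

End Potentials.

(** * Tail of the rank *)

Section RankTail.
Variable R : realFieldType.

Lemma iter_avg_ratio_pot_le b v l j : balanced l -> (2 < v <= (size l).+1)%N ->
  iter j (@avg R) (ratio_pot R b v) l <= ratio_pot R b v l.
Proof.
move=> bl hv.
apply: (@iter_avg_super _ (fun l => balanced l /\ (v <= (size l).+1)%N)).
- by move=> i l' hi [bl' vl']; split; [exact: balanced_stable|exact: leqW].
- by split=> //; case/andP: hv.
- move=> l' [bl' vl']; apply: avg_ratio_pot_le => //.
  by rewrite vl' andbT; case/andP: hv.
Qed.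

Lemma iter_avg_beats_new_le l i j : balanced l -> (0 < i <= (size l).+1)%N ->
  iter j (@avg R) (fun l' => (beats_root l' (size l).+2)%:R) (i :: l) <=
  8 * (inv_pot R true (i :: l) + inv_pot R false (i :: l)).
Proof.
move=> bl hi; have sl := balanced_size bl.
have bil := balanced_stable hi bl.
set v := (size l).+2.
apply: (@le_trans _ _ (iter j (@avg R)
    (fun l' => 4 * (ratio_pot R true v l' + ratio_pot R false v l')) (i :: l))).
  apply: (iter_avg_le balanced_stable) => // l' bl' sl'.
  by apply: beats_root_le_pot => //; rewrite sl' /= /v; lia.
rewrite iter_avgZ iter_avgD.
have pot b :
    iter j (@avg R) (ratio_pot R b v) (i :: l) <= 2 * inv_pot R b (i :: l).
  apply: le_trans (iter_avg_ratio_pot_le _ _ bil _) _.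
    by rewrite /v /=; lia.
  by rewrite /ratio_pot subtree_size_new ?mul1r //; case: bl.
have := pot true; have := pot false; lra.
Qed.

Lemma iter_avg_beats_root_le l k j : balanced l -> (k < j)%N ->
  iter j (@avg R) (fun l' => (beats_root l' ((size l).+2 + k))%:R) l <=
  8 * (inv_pot R true l + inv_pot R false l) *
  ((size l)%:R * ((size l)%:R - 1) /
    ((size l + k.+1)%:R * ((size l + k.+1)%:R - 1))).
Proof.
move=> bl kj; set q := (X in _ <= _ * X).
apply: (@le_trans _ _ (iter k.+1 (@avg R)
    (fun l' => 8 * (inv_pot R true l' + inv_pot R false l')) l)); last first.
  by rewrite iter_avgZ iter_avgD !iter_avg_inv_pot // -/q; lra.
have -> : j = (k + (j - k.+1).+1)%N by lia.
rewrite iterD [iter k.+1 _ _]iterSr.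
apply: (iter_avg_le balanced_stable) => // l' bl' sl'.
rewrite iterS /=; apply: avg_le => i hi.
have -> : ((size l).+2 + k = (size l').+2)%N by rewrite sl'; lia.
exact: iter_avg_beats_new_le.
Qed.

Lemma sum_inv_consecutive_le (m j : nat) : (1 < m)%N ->
  \sum_(0 <= k < j) ((m + k.+1)%:R * ((m + k.+1)%:R - 1))^-1 <= m%:R^-1 :> R.
Proof.
move=> m1.
suff -> : \sum_(0 <= k < j) ((m + k.+1)%:R * ((m + k.+1)%:R - 1))^-1 =
    m%:R^-1 - (m + j)%:R^-1 :> R.
  by rewrite gerBl invr_ge0.
move: m1; rewrite -(ltr_nat R) => m1.
elim: j => [|j IH]; first by rewrite big_nil addn0 subrr.
have j0 : 0 <= j%:R :> R by [].
rewrite big_nat_recr //= IH !natrD -natr1.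
by field; apply/and3P; split; apply: lt0r_neq0; lra.
Qed.

Definition root_rank (l : seq nat) :=
  betweenness_rank (size l).+1 (rec_tree l) 1.

Lemma rank_gt_balanced l x j : balanced l -> (2 * size l <= x)%N ->
  iter j (@avg R) (fun l' => (x < root_rank l')%N%:R) l <=
  16 / x%:R * ((size l)%:R - 1) * (inv_pot R true l + inv_pot R false l).
Proof.
move=> bl lx; have sl := balanced_size bl.
have x0 : 0 < x%:R :> R by rewrite ltr0n; lia.
apply: (@le_trans _ _ (iter j (@avg R) (fun l' =>
    2 / x%:R * \sum_(0 <= k < j) (beats_root l' ((size l).+2 + k))%:R) l)).
  apply: (iter_avg_le balanced_stable) => // l' bl' sl'.
  have [/rank_le_count|_] := boolP (x < root_rank l')%N; last first.
    by rewrite mulr_ge0 ?sumr_ge0 // divr_ge0 // ltW.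
  rewrite -/(beats_root l') (@big_cat_nat _ _ _ (size l).+2) /=; try lia.
  rewrite -{2}[(size l).+2]add0n big_addn.
  have -> : ((size l').+2 - (size l).+2 = j)%N by lia.
  have : (\sum_(2 <= v < (size l).+2) beats_root l' v <= size l)%N.
    apply: (@leq_trans (\sum_(2 <= v < (size l).+2) 1)%N).
      by apply: leq_sum => v _; exact: leq_b1.
    by rewrite sum_nat_const_nat; lia.
  move=> h1 h2.
  rewrite -natr_sum mulrAC ler_pdivlMr // mul1r -natrM ler_nat.
  apply: (@leq_trans (2 * (x - size l))%N); first lia.
  rewrite leq_mul2l /= leq_subLR; apply: leq_trans h2 _.
  apply: leq_add => //; apply/eq_leq/eq_big_nat => k _.
  by rewrite addnC.
rewrite iter_avgZ iter_avg_sum.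
set h := inv_pot R true l + _.
have h0 : 0 <= h by rewrite addr_ge0 // ltW // inv_pot_gt0.
apply: (@le_trans _ _ (2 / x%:R * \sum_(0 <= k < j) (8 * h *
  ((size l)%:R * ((size l)%:R - 1) /
    ((size l + k.+1)%:R * ((size l + k.+1)%:R - 1)))))).
  rewrite ler_wpM2l ?divr_ge0 ?(ltW x0) //.
  rewrite big_nat [X in _ <= X]big_nat.
  by apply: ler_sum => k hk; apply: iter_avg_beats_root_le => //; lia.
rewrite -mulr_sumr -mulr_sumr.
have := @sum_inv_consecutive_le (size l) j (ltn_trans _ sl).
set S := \sum_(_ <= _ < _) _ => /(_ isT).
move: sl; rewrite -(ltr_nat R) => sl HS.
have {}HS : (size l)%:R * S <= 1.
  by rewrite mulrC -ler_pdivlMr ?div1r //; lra.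
have -> : 2 / x%:R * (8 * h * ((size l)%:R * ((size l)%:R - 1) * S)) =
  16 / x%:R * ((size l)%:R - 1) * h * ((size l)%:R * S) by ring.
rewrite -[X in _ <= X]mulr1 ler_wpM2l // mulr_ge0 //.
by rewrite mulr_ge0 ?divr_ge0 ?(ltW x0) //; lra.
Qed.

Lemma avg_subtree2 (G : nat -> R) l : (0 < size l)%N ->
  avg (fun l' => G (subtree_size l' 2)) l =
  (size l).+1%:R^-1 * ((size l).+1%:R * G (subtree_size l 2) +
    (subtree_size l 2)%:R * (G (subtree_size l 2).+1 - G (subtree_size l 2))).
Proof.
move=> l0; rewrite /avg; congr (_ * _).
pose G2 (A D : nat) := G A.
transitivity (\sum_(1 <= i < (size l).+2)
    G2 (subtree_size l 2 + desc l 2 i)%N (0 + false)%N).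
  by apply: eq_big_nat => i hi; rewrite subtree_size_cons //; lia.
rewrite (sum_two_colours G2 (desc l 2) (fun=> false)) /G2.
ring.
Qed.

Lemma sum_by_parts (G : nat -> R) J :
  \sum_(1 <= s < J.+1) s%:R * (G s.+1 - G s) =
  J.+1%:R * G J.+1 - \sum_(1 <= s < J.+2) G s.
Proof.
elim: J => [|J IH]; first by rewrite big_nil big_nat1 mul1r subrr.
rewrite big_nat_recr //= IH [in RHS]big_nat_recr //= -[J.+2%:R]natr1.
ring.
Qed.

Lemma iter_avg_subtree2_uniform (G : nat -> R) j :
  iter j (@avg R) (fun l => G (subtree_size l 2)) [:: 1%N] =
  j.+1%:R^-1 * \sum_(1 <= s < j.+2) G s.
Proof.
elim: j G => [|j IH] G.
  rewrite /= big_nat1 invr1 mul1r; congr G.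
  by rewrite /subtree_size big_nat_recr //= big_nat1.
pose G' s := j.+2%:R^-1 * (j.+2%:R * G s + s%:R * (G s.+1 - G s)).
rewrite iterSr.
transitivity (iter j (@avg R) (fun l => G' (subtree_size l 2)) [:: 1%N]).
  apply: (iter_avg_eq valid_stable) => // l _ sl.
  by rewrite avg_subtree2 sl /= addn1.
rewrite IH /G' -mulr_sumr big_split /= -mulr_sumr sum_by_parts.
rewrite [\sum_(1 <= s < j.+3) G s]big_nat_recr //= -[j.+2%:R]natr1.
have j0 : 0 <= j%:R :> R by [].
rewrite -natr1; field; apply/andP; split; apply: lt0r_neq0; lra.
Qed.

Lemma sum_side_weight (c : R) k :
  \sum_(1 <= s < k.+3)
    (if (s < 3)%N then 1 else c * ((s%:R - 1) * (s%:R - 2))^-1) =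
  2 + c * (1 - k.+1%:R^-1).
Proof.
elim: k => [|k IH]; first by rewrite 2?big_nat_recr //= big_geq //; field.
rewrite big_nat_recr //= IH -!natr1.
have k0 : 0 <= k%:R :> R by [].
by field; apply/andP; split; apply: lt0r_neq0; lra.
Qed.

Lemma rank_tail n x : (0 < x <= n.+1)%N ->
  iter n (@avg R) (fun l => (x < root_rank l)%N%:R) [::] <= 48 / x%:R.
Proof.
move=> /andP[x0 xn].
have x0R : 0 < x%:R :> R by rewrite ltr0n.
have le1 F (l : seq nat) j : (forall l', F l' <= 1 :> R) ->
    iter j (@avg R) F l <= 1.
  move=> F1; rewrite -[X in _ <= X](iter_avg_cst 1 l j).
  by apply: (@iter_avg_le _ (fun=> True)).
have [x4|x4] := ltnP x 4.
  apply: (@le_trans _ _ 1); first by apply: le1 => l; rewrite lern1 leq_b1.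
  rewrite ler_pdivlMr // mul1r (ler_nat _ _ 48); lia.
have [k Ek] : exists k, x./2 = k.+2 by exists (x./2 - 2)%N; lia.
pose j := k.+1.
have -> : n = (j + (n - j.+1)).+1 by lia.
set r := (n - j.+1)%N.
rewrite iterS {1}/avg big_nat1 invr1 mul1r iterD.
pose c : R := 16 / x%:R * j%:R.
have c0 : 0 <= c by rewrite mulr_ge0 ?divr_ge0 // ltW.
pose g s : R := if (s < 3)%N then 1 else c * ((s%:R - 1) * (s%:R - 2))^-1.
have g0 s : 0 <= g s.
  rewrite /g; case: ltnP => // s3; rewrite mulr_ge0 // invr_ge0.
  by move: s3; rewrite -(ler_nat R) => s3; apply: mulr_ge0; lra.
pose G s := g s + g (j.+2 - s)%N.
apply: (@le_trans _ _
  (iter j (@avg R) (fun l => G (subtree_size l 2)) [:: 1%N])).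
  apply: (iter_avg_le valid_stable) => // l hl sl.
  have {}sl : size l = j.+1 by rewrite sl addn1.
  rewrite /G -sl -side_sizeF -side_sizeT.
  have [sT|sT] := ltnP (side_size true l) 3.
    apply: (@le_trans _ _ 1); first by apply: le1 => l'; rewrite lern1 leq_b1.
    by rewrite {1}/g sT lerDl.
  have [sF|sF] := ltnP (side_size false l) 3.
    apply: (@le_trans _ _ 1); first by apply: le1 => l'; rewrite lern1 leq_b1.
    by rewrite addrC {1}/g sF lerDl.
  have bl : balanced l by [].
  have lx : (2 * size l <= x)%N by lia.
  apply: le_trans (rank_gt_balanced _ bl lx) _.
  rewrite /g (ltnNge (side_size true _)) sT (ltnNge (side_size false _)) sF /=.
  by rewrite sl -[j.+1%:R]natr1 addrK -mulrDr.
rewrite iter_avg_subtree2_uniform big_split /=.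
rewrite [X in _ + X]big_nat_rev /=.
have -> : \sum_(1 <= s < j.+2) g (j.+2 - (1 + j.+2 - s.+1))%N =
    \sum_(1 <= s < j.+2) g s.
  by apply: eq_big_nat => s hs; congr g; lia.
rewrite sum_side_weight -mulr2n.
have k0 : 0 <= k%:R :> R by [].
have xj : x%:R <= 4 * j.+1%:R :> R by rewrite -natrM ler_nat; lia.
have i0 : 0 <= k.+1%:R^-1 :> R by [].
apply: (@le_trans _ _ (j.+1%:R^-1 * ((2 + c) *+ 2))).
  rewrite ler_wpM2l ?invr_ge0 // lerMn2r /= lerD2l -[X in _ <= X]mulr1.
  by rewrite ler_wpM2l //; lra.
rewrite mulrC ler_pdivrMr //.
rewrite /c; set y := x%:R.
have -> : 48 / y * j.+1%:R =
    16 / y * j%:R *+ 2 + 16 / y * 2 + 4 * (4 * j.+1%:R / y).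
  by rewrite -natr1 /y; field; lra.
have : 1 <= 4 * j.+1%:R / y by rewrite ler_pdivlMr ?mul1r.
have : 0 <= 16 / y by rewrite divr_ge0 // ltW.
lra.
Qed.

End RankTail.

(** * Law of the tree process *)

Lemma rec_tree_inj l l' : valid l -> valid l' -> size l = size l' ->
  rec_tree l =2 rec_tree l' -> l = l'.
Proof.
elim: l l' => [|i l IH] [|i' l'] //= /andP[hi hl] /andP[hi' hl'] [sl] E.
have ii : i = i'.
  have := E i (size l).+2; rewrite /add_edge sl !eqxx !orbT.
  case: (boolP (rec_tree l' _ _)) => [|_].
    by rewrite rec_tree_sym => /(rec_tree_range hl'); lia.
  by rewrite /= andbT => /esym/orP[/eqP//|]; lia.
rewrite -ii in E hi' *; congr (_ :: _); apply: IH => // u w.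
have [|big] := leqP (maxn u w) (size l).+1; last first.
  have no k : valid k -> size k = size l -> rec_tree k u w = false.
    move=> vk sk; apply/negP => e; have := rec_tree_range vk e.
    by rewrite rec_tree_sym in e; have := rec_tree_range vk e; lia.
  by rewrite !no.
move=> small; have := E u w; rewrite /add_edge -sl.
rewrite (_ : (w == (size l).+2) = false); last lia.
by rewrite (_ : (u == (size l).+2) = false) ?andbF ?orbF //; lia.
Qed.

Fixpoint histories (n : nat) : seq (seq nat) :=
  if n is m.+1 then [seq i :: l | l <- histories m, i <- index_iota 1 m.+2]
  else [:: [::]].

Lemma mem_histories n l :
  (l \in histories n) = (size l == n) && valid l.
Proof.
elim: n l => [|n IH] l; first by case: l.
apply/allpairsP/andP => [[[l' i] /= [hl' hi ->]]|[/eqP sl vl]].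
  move: hl' hi; rewrite IH mem_index_iota => /andP[/eqP sl' vl'] hi /=.
  by rewrite sl' eqxx vl' andbT; split=> //; lia.
case: l sl vl => // i l [sl] /= /andP[hi vl]; exists (l, i); split=> //=.
  by rewrite IH sl eqxx.
by rewrite mem_index_iota; lia.
Qed.

Lemma iter_avg_histories (R : realFieldType) (F : seq nat -> R) n :
  iter n (@avg R) F [::] = n`!%:R^-1 * \sum_(l <- histories n) F l.
Proof.
elim: n F => [|n IH] F; first by rewrite /= big_seq1 invr1 mul1r.
rewrite iterSr IH.
rewrite -[histories n.+1]/[seq i :: l | l <- histories n,
                                        i <- index_iota 1 n.+2].
rewrite big_allpairs_dep /= factS natrM invfM [X in _ = X * _]mulrC -mulrA.
congr (_ * _); rewrite mulr_sumr big_seq [RHS]big_seq.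
apply: eq_bigr => l; rewrite mem_histories => /andP[/eqP sl _].
by rewrite /avg sl.
Qed.

Fixpoint history (Omega : Type) (I : nat -> Omega -> nat) (n : nat)
    (w : Omega) : seq nat :=
  if n is m.+1 then I m.+1 w :: history I m w else [::].

Lemma size_history Omega (I : nat -> Omega -> nat) n w :
  size (history I n w) = n.
Proof. by elim: n => //= n ->. Qed.

Lemma valid_history Omega (I : nat -> Omega -> nat) n w :
  (forall k, (0 < k)%N -> (0 < I k w <= k)%N) -> valid (history I n w).
Proof. by move=> hI; elim: n => //= n ->; rewrite size_history hI. Qed.

Lemma drop_history Omega (I : nat -> Omega -> nat) n k w : (k <= n)%N ->
  drop (n - k) (history I n w) = history I k w.
Proof.
move=> kn; rewrite -{2}(subnK kn).
by elim: (n - k)%N => [|j IH]; rewrite ?add0n ?drop0 // addSn.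
Qed.

Section URRT.
Variables (R : realType) (d : measure_display) (Omega : measurableType d).
Variables (P : probability Omega R) (T : nat -> Omega -> rel nat).
Variable I : nat -> {RV P >-> nat}.
Hypothesis T1 : forall w, T 1%N w =2 (fun _ _ => false).
Hypothesis I_range : forall n w, (1 <= n)%N -> (1 <= I n w <= n)%N.
Hypothesis T_step : forall n w, (1 <= n)%N ->
  T n.+1 w =2 add_edge (T n w) (I n w) n.+1.
Hypothesis I_unif : forall n i : nat, (1 <= n)%N -> (1 <= i <= n)%N ->
  P [set w | I n w = i] = (n%:R^-1)%:E.
Hypothesis I_indep : forall (n i : nat) (g : nat -> rel nat), (1 <= n)%N ->
  let past := [set w | forall k, (1 <= k <= n)%N -> T k w =2 g k] in
  P ([set w | I n w = i] `&` past) = (P [set w | I n w = i] * P past)%E.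

Let hist := history I.

Lemma urrt_history n w : T n.+1 w = rec_tree (hist n w).
Proof.
elim: n => [|n IH]; apply/funext => u; apply/funext => v; first by rewrite T1.
by rewrite T_step // IH /= size_history.
Qed.

Let valid_hist n w : valid (hist n w).
Proof. by apply: valid_history => k k0; apply: I_range. Qed.

Lemma history_past n l : size l = n -> valid l ->
  [set w | forall k, (1 <= k <= n.+1)%N ->
    T k w =2 rec_tree (drop (n.+1 - k) l)] = [set w | hist n w = l].
Proof.
move=> sl vl; apply/seteqP; split=> w /=.
  move=> /(_ n.+1); rewrite subnn drop0 urrt_history => /(_ _) E.
  apply: rec_tree_inj => //; first by rewrite size_history.
  by apply: E; rewrite leqnn.
move=> <- [//|k] kn u v; rewrite urrt_history subSS drop_history //.
Qed.

Lemma history_atom n l : size l = n -> valid l ->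
  measurable [set w | hist n w = l] /\
  P [set w | hist n w = l] = (n`!%:R^-1)%:E.
Proof.
elim: n l => [|n IH] l sl vl.
  have -> : [set w | hist 0 w = l] = setT.
    by apply/seteqP; split=> w //= _; rewrite (size0nil sl).
  by rewrite probability_setT fact0 invr1.
case: l sl vl => // i l [sl] /= /andP[hi vl].
have [mH PH] := IH l sl vl.
have -> : [set w | hist n.+1 w = i :: l] =
    [set w | I n.+1 w = i] `&` [set w | hist n w = l].
  apply/seteqP; split=> w /= [e1 e2]; first by split.
  by rewrite -e1 -e2.
split.
  apply: measurableI => //.
  exact: (measurable_funPTI (I n.+1) (_ : measurable [set i])).
rewrite -history_past // I_indep // history_past // PH I_unif // -?sl //.
by rewrite -EFinM sl factS natrM invfM.
Qed.

Lemma urrt_prob_le n (A : pred (rel nat)) :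
  (P [set w | A (T n.+1 w)] <=
    (iter n (@avg R) (fun l => (A (rec_tree l))%:R) [::])%:E)%E.
Proof.
have atoms (s : seq (seq nat)) : {subset s <= histories n} ->
    measurable [set w | hist n w \in s] /\
    (P [set w | hist n w \in s] <= (n`!%:R^-1 * (size s)%:R)%:E)%E.
  elim: s => [_|l s IH sub].
    rewrite (_ : mkset _ = set0); last by apply/seteqP; split.
    by rewrite measure0 mulr0.
  have [|ms Ps] := IH; first by move=> k ks; apply: sub; rewrite inE ks orbT.
  have := sub l; rewrite mem_head mem_histories => /(_ isT) /andP[/eqP sl vl].
  have [ml Pl] := history_atom sl vl.
  have -> : [set w | hist n w \in l :: s] =
      [set w | hist n w = l] `|` [set w | hist n w \in s].
    apply/seteqP; split=> w /=; rewrite inE.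
      by case/orP=> [/eqP|]; [left|right].
    by case=> [->|->]; rewrite ?eqxx ?orbT.
  split; first exact: measurableU.
  apply: le_trans (measureU2 _ _ _) _ => //.
  rewrite -[size _]/(size s).+1 -natr1 mulrDr mulr1 EFinD -Pl addeC.
  exact: leeD2l.
have [|_] := atoms [seq l <- histories n | A (rec_tree l)].
  by move=> l; rewrite mem_filter => /andP[].
have -> : iter n (@avg R) (fun l => (A (rec_tree l))%:R) [::] =
    n`!%:R^-1 * (size [seq l <- histories n | A (rec_tree l)])%:R.
  rewrite iter_avg_histories -natr_sum size_filter -sum1_count.
  rewrite [in RHS]big_mkcond.
  by congr (_ * _%:R); apply: eq_bigr => l _ /=; case: (A _).
apply: le_trans; rewrite le_eqVlt; apply/orP; left; apply/eqP; congr (P _).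
apply/seteqP; split=> w /=; rewrite urrt_history mem_filter.
  by move=> ->; rewrite mem_histories size_history eqxx valid_hist.
by case/andP.
Qed.

End URRT.

Theorem lemma19 (R : realType) (d : measure_display)
    (Omega : measurableType d) (P : probability Omega R)
    (T : nat -> Omega -> rel nat) (hT : is_urrt P T) :
  exists c : R, 0 < c /\
    forall n x : nat, (1 <= n)%N -> (1 <= x <= n)%N ->
      (P [set w | (x < betweenness_rank n (T n w) 1)%N] <= (c / x%:R)%:E)%E.
Proof.
case: hT => T1 [I hI]; exists 48; split=> // -[//|n] x _ hx.
apply: le_trans (urrt_prob_le (I := I) T1 _ _ _ _ n
  (fun e => (x < betweenness_rank n.+1 e 1)%N)) _.
- by move=> k w /hI[].
- by move=> k w /hI[].
- by move=> k i /hI[_ _ + _]; apply.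
- by move=> k i g /hI[_ _ _]; apply.
rewrite lee_fin; apply: le_trans (rank_tail R hx).
apply: (iter_avg_le valid_stable) => // l _ sl.
by rewrite /root_rank sl addn0.
Qed.
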